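(* Let $a>0$ be constant, $\Omega=[x_L,x_R]$, and let $\tau_L<-\tfrac12$ be a constant. Consider the SAT-RBF semidiscretization of $\partial_t u+\partial_x(au)=0$ with boundary condition $u(t,x_L)=g(t)$, $$\partial_t u_N = - f_N' + SAT_L + SAT_R,\qquad u_N(0)=(u_{\mathrm{init}})_N,$$ with $$SAT_L=\tau_L a^+\delta_{x_L}(u_N-g),\qquad SAT_R=\tau_R a^-\delta_{x_R}(u_N-g),\qquad a^+=\max\{a,0\},\ a^-=\min\{a,0\}$$ (so that $SAT_R=0$). Then the SAT-RBF method is strongly energy stable: there exists $K:[0,\infty)\to[0,\infty)$, bounded for any finite $t$ and independent of $u_{\mathrm{init}}$, $g$ and $N$, such that for every solution $u_N$ and all $t\ge0$ $$\|u_N(t)\|^2 \leq K(t) \left( \|(u_{\mathrm{init}})_N\|^2 + \max_{s \in [0,t]} |g(s)|^2 \right),$$ where $\|w\|^2=\int_\Omega w(x)^2\,\mathrm{d}x$.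
   Context: RBF space: let $\phi:[0,\infty)\to\mathbb{R}$ be a radial basis function, $m\in\mathbb{N}$, and $X=\{x_n\}_{n=1}^N\subset\Omega$ a set of $N$ distinct centers (for each $N$ under consideration). Let $p_1,\dots,p_Q$ be a basis of the polynomials of degree less than $m$. $V_{N,m}$ is the space of all functions $$v(x)=\sum_{n=1}^N\alpha_n\phi(|x-x_n|)+\sum_{i=1}^Q\beta_ip_i(x)\quad\text{with}\quad \sum_{n=1}^N\alpha_np_i(x_n)=0,\ i=1,\dots,Q.$$ It is assumed that interpolation at the centers is uniquely solvable in $V_{N,m}$ (so $\dim V_{N,m}=N$). The RBF interpolant of a function $w$ is the unique $v\in V_{N,m}$ with $v(x_n)=w(x_n)$ for $n=1,\dots,N$. At each time $t$, $u_N(t)=u_N(t,\cdot)\in V_{N,m}$ is the approximation of the solution, and $f_N(t,\cdot)\in V_{N,m}$ is the corresponding RBF interpolant of the flux $f(u)=au$ (so $f_N=au_N$). $(u_{\mathrm{init}})_N\in V_{N,m}$ is the approximation of the initial condition $u_{\mathrm{init}}$. A prime denotes $\partial_x$. Functions in $V_{N,m}$ are continuously differentiable on $\Omega$; $u_N$ is continuous in $t\ge 0$ and continuously differentiable in $t>0$; $g$ is continuous on $[0,\infty)$. Dirac terms: $\delta_{x_L}$ is the generalized function with $\int_\Omega v(x)\delta_{x_L}(x)\,\mathrm{d}x=v(x_L)$ (the full boundary value), and similarly for $\delta_{x_R}$. The semidiscretization is accordingly understood after testing: for all $t>0$ and all $v\in V_{N,m}$, $$\int_\Omega v\,\partial_tu_N\,\mathrm{d}x=-\int_\Omega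 v\,f_N'\,\mathrm{d}x+\tau_L a^+v(x_L)\left(u_N(t,x_L)-g(t)\right)+\tau_Ra^-v(x_R)\left(u_N(t,x_R)-g(t)\right).$$ The constant $K(t)$ may depend on the fixed data $a$ and $\tau_L$. *)

(* Defs.v *)
From HB Require Import structures.
From mathcomp Require Import all_boot all_order all_algebra.
From mathcomp Require Import all_classical all_reals all_analysis.
Set Implicit Arguments.
Unset Strict Implicit.
Unset Printing Implicit Defensive.
Import Order.TTheory GRing.Theory Num.Theory.
Import numFieldNormedType.Exports.
Local Open Scope classical_set_scope.
Local Open Scope ring_scope.

(* Functions on Omega = [xL, xR] are represented by total functions R -> R
   whose values outside [xL, xR] are irrelevant. *)

(* Continuously differentiable on the closed interval: continuous there,
   differentiable inside, with a derivative that extends continuously up to the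
   end points. *)
Definition C1_on (R : realType) (xL xR : R) (v : R -> R) : Prop :=
  derivable_oo_LRcontinuous v xL xR /\
  exists2 dv : R -> R, {within `[xL, xR], continuous dv}
                     & {in `]xL, xR[, derive1 v =1 dv}.

(* The space V_{N,m}.  Only the values of phi on [0, +oo[ are used; p lists the
   basis p_1, ..., p_Q of the polynomials of degree less than m. *)
Definition rbf_space (R : realType) (xL xR : R) (phi : R -> R) (m N Q : nat)
    (X : 'I_N -> R) (p : Q.-tuple {poly_m R}) : set (R -> R) :=
  [set v | exists alpha : 'I_N -> R, exists beta : 'I_Q -> R,
     (forall i : 'I_Q, \sum_(n < N) alpha n * (tnth p i : {poly R}).[X n] = 0) /\
     {in `[xL, xR], forall x : R,
        v x = \sum_(n < N) alpha n * phi `|x - X n|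
              + \sum_(i < Q) beta i * (tnth p i : {poly R}).[x]}].

Definition interpolates (R : realType) (V : set (R -> R)) (N : nat)
    (X : 'I_N -> R) (w v : R -> R) : Prop :=
  V v /\ forall n : 'I_N, v (X n) = w (X n).

(* Uniqueness is as a function on Omega. *)
Definition uniquely_solvable (R : realType) (xL xR : R) (V : set (R -> R))
    (N : nat) (X : 'I_N -> R) : Prop :=
  forall w : R -> R, exists2 v : R -> R, interpolates V X w v &
    forall v' : R -> R, interpolates V X w v' -> {in `[xL, xR], v' =1 v}.

Definition l2norm_sq (R : realType) (xL xR : R) (w : R -> R) : R :=
  \int[lebesgue_measure]_(x in `[xL, xR]) w x ^+ 2.

(* The semidiscretization at time t, tested against v.  Testing the Dirac
   terms produces the full boundary values of v. *)
Definition sat_rbf_weak_eq (R : realType) (xL xR a tauL tauR : R) (g : R -> R)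
    (u f : R -> R -> R) (t : R) (v : R -> R) : Prop :=
  \int[lebesgue_measure]_(x in `[xL, xR]) (v x * derive1 (fun s => u s x) t) =
    - (\int[lebesgue_measure]_(x in `[xL, xR]) (v x * derive1 (f t) x))
    + tauL * Num.max a 0 * v xL * (u t xL - g t)
    + tauR * Num.min a 0 * v xR * (u t xR - g t).

(* u t x stands for u_N(t, x) and f t x for f_N(t, x).  Regularity in time is
   required at each point of Omega; as V is finite dimensional this is the same
   as regularity of t |-> u_N(t) in V. *)
Record sat_rbf_solution (R : realType) (xL xR a tauL tauR : R)
    (V : set (R -> R)) (N : nat) (X : 'I_N -> R) (g uinitN : R -> R)
    (u f : R -> R -> R) : Prop := SatRbfSolution {
  sol_space : forall t : R, 0 <= t -> V (u t) ;
  sol_flux : forall t : R, 0 <= t -> interpolates V X (fun x => a * u t x) (f t) ;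
  sol_continuous : {in `[xL, xR], forall x : R,
    {within `[0, +oo[, continuous (fun t => u t x)}} ;
  sol_C1 : {in `[xL, xR], forall x : R, forall t : R, 0 < t ->
    derivable (fun s => u s x) t 1 /\
    {for t, continuous (derive1 (fun s => u s x))}} ;
  sol_init : {in `[xL, xR], u 0 =1 uinitN} ;
  sol_eq : forall (t : R) (v : R -> R), 0 < t -> V v ->
    sat_rbf_weak_eq xL xR a tauL tauR g u f t v }.

(* Main.v *)
(* Energy method.  Unisolvence gives a cardinal basis c_n of V, so that
   u(t) = sum_n u(t, x_n) c_n and E(t) = ||u(t)||^2 is a quadratic form in the
   nodal values; hence E is continuous on [0, +oo[ and E' = 2 int u u_t for t > 0.
   Testing the scheme with v = u(t), where f = a u on Omega, yields
     E' = - a u(xR)^2 + a (1 + 2 tauL) u(xL)^2 - 2 a tauL u(xL) g <= C g^2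
   with C = a tauL^2 / (- 1 - 2 tauL), by completing the square.  Therefore
   E(s) - C s max g^2 is nonincreasing on [0, t], and K(t) = 1 + C t works. *)

Require Import Defs.
From mathcomp Require Import all_boot all_order all_algebra.
From mathcomp Require Import all_classical all_reals all_analysis.
From mathcomp Require Import measurable_realfun.
From mathcomp Require Import ring lra.
Set Implicit Arguments.
Unset Strict Implicit.
Unset Printing Implicit Defensive.
Import Order.TTheory GRing.Theory Num.Theory.
Import numFieldNormedType.Exports.
Local Open Scope classical_set_scope.
Local Open Scope ring_scope.

(** * Integrals of combinations of continuous functions *)

Lemma within_continuousM_real (R : realType) (A : set R) (f g : R -> R) :
  {within A, continuous f} -> {within A, continuous g} ->
  {within A, continuous (fun x => f x * g x)}.
Proof. by move=> cf cg x; apply: cvgM; [exact: cf|exact: cg]. Qed.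

Lemma within_continuous_sum (R : realType) (A : set R) (I : Type) (r : seq I)
    (h : I -> R -> R) :
  (forall i, {within A, continuous (h i)}) ->
  {within A, continuous (fun x => \sum_(i <- r) h i x)}.
Proof.
move=> ch; apply: (@continuous_big _ _ _ _ xpredT _ (subspace A)).
  exact: (@pseudometric_normed_Zmodule.add_continuous R R).
by move=> i _; exact: ch.
Qed.

Lemma integrable_segment (R : realType) (a b : R) (f : R -> R) :
  {within `[a, b], continuous f} ->
  (@lebesgue_measure R).-integrable `[a, b] (EFin \o f).
Proof.
by move=> cf; apply: continuous_compact_integrable => //; exact: segment_compact.
Qed.

Lemma Rintegral_linear_comb (R : realType) (a b : R) (I : Type) (r : seq I)
    (k : I -> R) (h : I -> R -> R) :
  (forall i, {within `[a, b], continuous (h i)}) ->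
  \int[lebesgue_measure]_(x in `[a, b]) (\sum_(i <- r) k i * h i x) =
  \sum_(i <- r) k i * \int[lebesgue_measure]_(x in `[a, b]) h i x.
Proof.
move=> ch.
have ckh i : {within `[a, b], continuous (fun x => k i * h i x)}.
  by apply: within_continuousM_real => // x; exact: cvg_cst.
elim: r => [|i r IHr].
  under eq_Rintegral do rewrite big_nil.
  by rewrite big_nil Rintegral_cst// mul0r.
under eq_Rintegral do rewrite big_cons.
rewrite big_cons -IHr RintegralD//.
- by rewrite RintegralZl//; exact: integrable_segment.
- exact: integrable_segment.
- by apply: integrable_segment; exact: within_continuous_sum.
Qed.

(** Serves twice, with the same Gram matrix: with [k = l] for the energy, and with nodal values
    against their time derivatives for the integral of [u] times its time derivative. *)
Lemma Rintegral_bilinear_comb (R : realType) (a b : R) (N : nat)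
    (k l : 'I_N -> R) (h : 'I_N -> R -> R) :
  (forall i, {within `[a, b], continuous (h i)}) ->
  \int[lebesgue_measure]_(x in `[a, b])
    ((\sum_(i < N) k i * h i x) * (\sum_(j < N) l j * h j x)) =
  \sum_(i < N) \sum_(j < N) k i * l j *
    \int[lebesgue_measure]_(x in `[a, b]) (h i x * h j x).
Proof.
move=> ch.
transitivity (\int[lebesgue_measure]_(x in `[a, b])
    \sum_(i < N) k i * (h i x * \sum_(j < N) l j * h j x)).
  apply: eq_Rintegral => x _; rewrite mulr_suml.
  by apply: eq_bigr => i _; rewrite mulrA.
rewrite Rintegral_linear_comb; last first.
  move=> i; apply: within_continuousM_real => //.
  apply: within_continuous_sum => j.
  by apply: within_continuousM_real => // x; exact: cvg_cst.
apply: eq_bigr => i _.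
transitivity (k i * \int[lebesgue_measure]_(x in `[a, b])
    \sum_(j < N) l j * (h i x * h j x)).
  congr (_ * _); apply: eq_Rintegral => x _; rewrite mulr_sumr.
  by apply: eq_bigr => j _; rewrite mulrCA.
rewrite Rintegral_linear_comb; last by move=> j; exact: within_continuousM_real.
by rewrite mulr_sumr; apply: eq_bigr => j _; rewrite mulrA.
Qed.

(** The end points form a null set, and inside [f] inherits measurability from [g]. This is needed
    for [derive1], a two-sided derivative that at an end point sees irrelevant values outside the
    interval. *)
Lemma eq_Rintegral_oo (R : realType) (a b : R) (f g : R -> R) :
  {within `[a, b], continuous g} -> {in `]a, b[, f =1 g} ->
  \int[lebesgue_measure]_(x in `[a, b]) f x =
  \int[lebesgue_measure]_(x in `[a, b]) g x.
Proof.
move=> cg fg.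
have mg : measurable_fun `]a, b[ g.
  apply: (measurable_funS (measurable_itv `[a, b])).
    exact: subset_itv_oo_cc.
  exact: subspace_continuous_measurable_fun.
have mf : measurable_fun `]a, b[ f.
  by apply: (eq_measurable_fun g) => // x; rewrite inE /= => /fg ->.
rewrite /Rintegral; congr fine.
rewrite integral_itv_bndoo; last exact/measurable_EFinP.
rewrite [RHS]integral_itv_bndoo; last exact/measurable_EFinP.
by apply: eq_integral => x; rewrite inE => /fg ->.
Qed.

(** * Boundary values from the flux term *)

Lemma C1_on_within_continuous (R : realType) (a b : R) (v : R -> R) :
  C1_on a b v -> {within `[a, b], continuous v}.
Proof. by move=> [/derivable_oo_LRcontinuous_within]. Qed.

Lemma C1_on_flux_integral (R : realType) (a b c : R) (v f : R -> R) :
  a < b -> C1_on a b v -> {in `[a, b], forall x, f x = c * v x} ->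
  \int[lebesgue_measure]_(x in `[a, b]) (v x * derive1 f x) =
  c / 2 * (v b ^+ 2 - v a ^+ 2).
Proof.
move=> ab C1v fv; have cv := C1_on_within_continuous C1v.
case: C1v => [dv [w cw vw]].
have ivw : \int[lebesgue_measure]_(x in `[a, b]) (v x * w x) =
    (v b ^+ 2 - v a ^+ 2) / 2.
  (* Integrating [v] by parts against itself returns the same integral with opposite sign, so it
     equals half the boundary term. *)
  have := Rintegration_by_parts ab cw dv vw cw dv vw.
  under [X in _ - X]eq_Rintegral do rewrite mulrC.
  by move=> H; lra.
have cvw := within_continuousM_real cv cw.
transitivity (\int[lebesgue_measure]_(x in `[a, b]) (c * (v x * w x))).
  apply: eq_Rintegral_oo.
    by apply: within_continuousM_real => // x; exact: cvg_cst.
  move=> x xab; rewrite mulrCA; congr (_ * _).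
  rewrite -(vw _ xab) !derive1E.
  case: dv => dv _ _.
  (* [f = c * v] is known on the interval only; an interior point has a neighbourhood contained in
     it, which suffices for the derivatives to agree. *)
  transitivity ('D_1 (c \*: v) x).
    apply: near_eq_derive; near=> y.
    by apply: fv; apply: subset_itv_oo_cc; near: y; exact: near_in_itvoo.
  by rewrite deriveZ//; exact: dv.
rewrite RintegralZl ?ivw//; first by lra.
exact: integrable_segment.
Unshelve. all: by end_near. Qed.

(** * Differentiation of a quadratic form *)

Lemma is_derive_quadratic_form (R : realType) (N : nat) (U : 'I_N -> R -> R)
    (G : 'I_N -> 'I_N -> R) (t : R) :
  (forall i, derivable (U i) t 1) ->
  is_derive t 1 (fun s => \sum_(i < N) \sum_(j < N) U i s * U j s * G i j)
    (\sum_(i < N) \sum_(j < N) derive1 (U i) t * U j t * G i j +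
     \sum_(i < N) \sum_(j < N) U i t * derive1 (U j) t * G i j).
Proof.
move=> dU.
have dU' i : is_derive t 1 (U i) (derive1 (U i) t).
  by rewrite derive1E; exact: derivableP.
(* As a sum of functions, the form is differentiated by the inferred rules for sums, scalings and
   products. *)
have -> : (fun s => \sum_(i < N) \sum_(j < N) U i s * U j s * G i j) =
    \sum_(i < N) \sum_(j < N) (G i j \*: (U i * U j)).
  apply/funext => s; rewrite fct_sumE; apply: eq_bigr => i _.
  rewrite fct_sumE; apply: eq_bigr => j _.
  by rewrite mulrC.
apply: is_derive_eq.
rewrite -big_split; apply: eq_bigr => i _ /=.
rewrite -big_split; apply: eq_bigr => j _ /=.
rewrite /GRing.scale /=; ring.
Qed.

(** * Linear structure and cardinal basis of the RBF space *)

Lemma rbf_space0 (R : realType) (xL xR : R) (phi : R -> R) (m N Q : nat)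
    (X : 'I_N -> R) (p : Q.-tuple {poly_m R}) : rbf_space xL xR phi X p (fun=> 0).
Proof.
exists (fun=> 0), (fun=> 0); split=> [i|x _].
  by rewrite big1// => n _; rewrite mul0r.
by rewrite !big1 ?addr0// => n _; rewrite mul0r.
Qed.

Lemma rbf_space_scale_add (R : realType) (xL xR : R) (phi : R -> R) (m N Q : nat)
    (X : 'I_N -> R) (p : Q.-tuple {poly_m R}) (c : R) (v w : R -> R) :
  rbf_space xL xR phi X p v -> rbf_space xL xR phi X p w ->
  rbf_space xL xR phi X p (fun x => c * v x + w x).
Proof.
move=> [al [be [orth vE]]] [al' [be' [orth' wE]]].
exists (fun n => c * al n + al' n), (fun i => c * be i + be' i).
have combE (I : finType) (k k' h : I -> R) :
    \sum_i (c * k i + k' i) * h i = c * (\sum_i k i * h i) + \sum_i k' i * h i.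
  rewrite mulr_sumr -big_split; apply: eq_bigr => i _ /=; ring.
split=> [i|x xI]; first by rewrite combE orth orth' mulr0 addr0.
by rewrite !combE vE// wE//; ring.
Qed.

Lemma rbf_space_sum (R : realType) (xL xR : R) (phi : R -> R) (m N Q : nat)
    (X : 'I_N -> R) (p : Q.-tuple {poly_m R}) (I : Type) (r : seq I)
    (k : I -> R) (c : I -> R -> R) :
  (forall i, rbf_space xL xR phi X p (c i)) ->
  rbf_space xL xR phi X p (fun x => \sum_(i <- r) k i * c i x).
Proof.
move=> Vc; elim: r => [|i r IHr].
  rewrite (_ : (fun _ => _) = fun=> 0); first exact: rbf_space0.
  by apply/funext => x; rewrite big_nil.
rewrite (_ : (fun _ => _) = fun x => k i * c i x + \sum_(j <- r) k j * c j x).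
  exact: rbf_space_scale_add.
by apply/funext => x; rewrite big_cons.
Qed.

(** Take [c n] interpolating the indicator of [X n]. As the centers are distinct, [v] and its nodal
    expansion both interpolate [v], so uniqueness makes them agree on Omega. *)
Lemma cardinal_basis (R : realType) (xL xR : R) (phi : R -> R) (m N Q : nat)
    (X : 'I_N -> R) (p : Q.-tuple {poly_m R}) :
  injective X -> uniquely_solvable xL xR (rbf_space xL xR phi X p) X ->
  exists c : 'I_N -> R -> R, (forall n, rbf_space xL xR phi X p (c n)) /\
    forall v, rbf_space xL xR phi X p v ->
      {in `[xL, xR], forall x, v x = \sum_(n < N) v (X n) * c n x}.
Proof.
move=> Xinj usolv.
have /choice[c cP] (n : 'I_N) : exists v : R -> R,
    interpolates (rbf_space xL xR phi X p) X (fun x => (x == X n)%:R) v.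
  by have [v Hv _] := usolv (fun x => (x == X n)%:R); exists v.
exists c; split=> [n|v Vv x xI]; first by case: (cP n).
have [w _ wuniq] := usolv v.
rewrite (wuniq v)// -(wuniq (fun x => \sum_(n < N) v (X n) * c n x))//.
split; first by apply: rbf_space_sum => n; case: (cP n).
move=> k; rewrite (bigD1 k)//= (cP k).2 eqxx mulr1 big1 ?addr0// => n nk.
by rewrite (cP n).2 (inj_eq Xinj) eq_sym (negPf nk) mulr0.
Qed.

(** * Bounds on the boundary data *)

Lemma within_continuous_itvcyW (R : realType) (a b : R) (g : R -> R) :
  {within `[a, +oo[, continuous g} -> {within `[a, b], continuous g}.
Proof.
by apply: continuous_subspaceW; apply: subset_itvl; rewrite bnd_simp.
Qed.

Lemma within_itv0_sqr_le_sup (R : realType) (g : R -> R) (t s : R) :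
  {within `[0, +oo[, continuous g} -> 0 <= s -> s <= t ->
  g s ^+ 2 <= sup [set `|g r| ^+ 2 | r in `[0, t]].
Proof.
move=> cg s0 st.
have ct : {within `[0, t], continuous (fun r => g r * g r)}.
  apply: within_continuous_itvcyW.
  exact: within_continuousM_real.
(* [sup] dominates the members of a set only if the set is bounded above; the extreme value theorem
   supplies the bound. *)
have [c _ cmax] := EVT_max (le_trans s0 st) ct.
apply: sup_ubound.
  exists (g c * g c) => _ [r /= rt <-].
  by rewrite real_normK ?num_real// expr2; exact: cmax.
by exists s; rewrite /= ?in_itv/= ?s0// real_normK// num_real.
Qed.

(** With [d = - 1 - 2 * tau], the gap between the sides is [a * uR ^+ 2 + a / d * (d * uL + tau * g)
    ^+ 2]; positivity of [d] is exactly the condition on [tau]. *)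
Lemma sat_boundary_bound (R : realType) (a tau uL uR g : R) :
  0 < a -> tau < - 2^-1 ->
  2 * (- (a / 2 * (uR ^+ 2 - uL ^+ 2)) + tau * a * uL * (uL - g)) <=
  a * tau ^+ 2 / (- 1 - 2 * tau) * g ^+ 2.
Proof.
move=> a0 tau12; set d := - 1 - 2 * tau.
have d0 : 0 < d by rewrite /d; lra.
have -> : a * tau ^+ 2 / d * g ^+ 2 =
    2 * (- (a / 2 * (uR ^+ 2 - uL ^+ 2)) + tau * a * uL * (uL - g)) +
    (a * uR ^+ 2 + a / d * (d * uL + tau * g) ^+ 2).
  by rewrite {1}/d /d; field; rewrite gt_eqF.
by rewrite lerDl addr_ge0// mulr_ge0 ?sqr_ge0 ?divr_ge0// ltW.
Qed.

(** * The energy estimate *)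

Theorem lemma5p1 (R : realType) (a tauL : R) (ha : 0 < a) (htauL : tauL < - 2^-1) :
  exists K : R -> R,
    (forall t : R, 0 <= t -> 0 <= K t) /\
    (forall T : R, 0 <= T ->
       exists M : R, forall t : R, 0 <= t -> t <= T -> K t <= M) /\
    (forall (xL xR tauR : R) (phi : R -> R) (m N Q : nat) (X : 'I_N -> R)
        (p : Q.-tuple {poly_m R}) (g uinitN : R -> R) (u f : R -> R -> R),
      xL < xR ->
      injective X ->
      (forall n : 'I_N, X n \in `[xL, xR]) ->
      basis_of {: {poly_m R}}%VS p ->
      uniquely_solvable xL xR (rbf_space xL xR phi X p) X ->
      (forall v : R -> R, rbf_space xL xR phi X p v -> C1_on xL xR v) ->
      {within `[0, +oo[, continuous g} ->
      rbf_space xL xR phi X p uinitN ->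
      sat_rbf_solution xL xR a tauL tauR (rbf_space xL xR phi X p) X g uinitN u f ->
      forall t : R, 0 <= t ->
        l2norm_sq xL xR (u t) <=
          K t * (l2norm_sq xL xR uinitN + sup [set `|g s| ^+ 2 | s in `[0, t]])).
Proof.
pose C := a * tauL ^+ 2 / (- 1 - 2 * tauL).
have C0 : 0 <= C.
  apply: divr_ge0; first by rewrite mulr_ge0 ?sqr_ge0// ltW.
  by lra.
(* [C] involves only [a] and [tauL], so [K] is fixed before the centers, the space and the data are
   introduced. *)
exists (fun t => 1 + C * t); split.
  by move=> t t0; rewrite addr_ge0// mulr_ge0.
split.
  by move=> T _; exists (1 + C * T) => t _ tT; rewrite lerD2l ler_wpM2l.
move=> xL xR tauR phi m N Q X p g uinitN u f xLR Xinj XI _ usolv VC1 cg Vinit sol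
  t t0.
have [c [Vc cE]] := cardinal_basis Xinj usolv.
have cc i : {within `[xL, xR], continuous (c i)}.
  exact/C1_on_within_continuous/VC1.
(* Time enters only through the finitely many nodal values [U i], so no differentiation under the
   integral sign is required. *)
pose U i s := u s (X i).
pose G i j := \int[lebesgue_measure]_(x in `[xL, xR]) (c i x * c j x).
pose E s := \sum_(i < N) \sum_(j < N) U i s * U j s * G i j.
have uE (s : R) : 0 <= s ->
    {in `[xL, xR], forall x, u s x = \sum_(i < N) U i s * c i x}.
  by move=> s0; apply: cE; exact: sol_space sol _ s0.
have EE (s : R) : 0 <= s -> l2norm_sq xL xR (u s) = E s.
  move=> s0; rewrite /E -Rintegral_bilinear_comb//.
  by apply: eq_Rintegral => x; rewrite inE => xI; rewrite expr2 uE.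
have cU i : {within `[0, +oo[, continuous (U i)}.
  exact: sol_continuous sol _ (XI i).
have cE0 : {within `[0, t], continuous E}.
  apply: within_continuous_itvcyW.
  do 2![apply: within_continuous_sum => ?].
  apply: within_continuousM_real; first exact: within_continuousM_real.
  by move=> ?; exact: cvg_cst.
have dU i (s : R) : 0 < s -> derivable (U i) s 1.
  by move=> s0; case: (sol_C1 sol (XI i) s0).
have utE (s x : R) : 0 < s -> x \in `[xL, xR] ->
    derive1 (fun r => u r x) s = \sum_(i < N) derive1 (U i) s * c i x.
  move=> s0 xI; rewrite derive1E.
  (* The nodal expansion holds for nonnegative times only, hence near any [s > 0]. *)
  transitivity ('D_1 (\sum_(i < N) (c i x \*: U i)) s).
    apply: near_eq_derive; near=> r.
    rewrite fct_sumE uE ?ltW//; last by near: r; exact: lt_nbhsr.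
    by apply: eq_bigr => i _; rewrite mulrC.
  have dcU i : derivable (c i x \*: U i) s 1 by apply: derivableZ; exact: dU.
  rewrite derive_sum//; apply: eq_bigr => i _.
  by rewrite deriveZ ?derive1E; [rewrite mulrC|exact: dU].
pose M := sup [set `|g s| ^+ 2 | s in `[0, t]].
have dE (s : R) : 0 < s -> is_derive s 1 E
    (2 * (- (a / 2 * (u s xR ^+ 2 - u s xL ^+ 2))
          + tauL * a * u s xL * (u s xL - g s))).
  move=> s0; have s0' := ltW s0.
  apply: (is_derive_eq (is_derive_quadratic_form G (fun i => dU i s s0))).
  have <- : \int[lebesgue_measure]_(x in `[xL, xR])
      (u s x * derive1 (fun r => u r x) s) =
      - (a / 2 * (u s xR ^+ 2 - u s xL ^+ 2))
      + tauL * a * u s xL * (u s xL - g s).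
    (* The scheme is tested with [u s]; since [a > 0], the right boundary term vanishes. *)
    rewrite (sol_eq sol s0 (sol_space sol s0')) max_l ?(ltW ha)//.
    rewrite min_r ?(ltW ha)// mulr0 !mul0r addr0; congr (- _ + _).
    apply: C1_on_flux_integral => //; first exact/VC1/(sol_space sol s0').
    (* [a * u s] lies in the space and interpolates itself, so by uniqueness it agrees with [f s] on
       Omega. *)
    have [w _ wuniq] := usolv (fun x => a * u s x).
    move=> x xI; rewrite (wuniq _ (sol_flux sol s0'))//.
    rewrite -(wuniq (fun x => a * u s x))//.
    split=> //.
    have := rbf_space_scale_add a (sol_space sol s0') (rbf_space0 xL xR phi X p).
    by under eq_fun do rewrite addr0.
  have -> : \int[lebesgue_measure]_(x in `[xL, xR])
      (u s x * derive1 (fun r => u r x) s) =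
      \sum_(i < N) \sum_(j < N) U i s * derive1 (U j) s * G i j.
    rewrite -Rintegral_bilinear_comb//; apply: eq_Rintegral => x; rewrite inE => xI.
    by rewrite uE// utE.
  (* The product rule gives two sums, equal by the symmetry of [G]; hence the factor 2. *)
  rewrite mulr2n mulrDl mul1r; congr (_ + _).
  rewrite exchange_big; apply: eq_bigr => i _; apply: eq_bigr => j _.
  rewrite (_ : G j i = G i j); first by rewrite [X in X * _]mulrC.
  by apply: eq_Rintegral => x _; rewrite mulrC.
have dH (s : R) : 0 < s -> is_derive s 1 (fun r => E r - C * M * r)
    (2 * (- (a / 2 * (u s xR ^+ 2 - u s xL ^+ 2))
          + tauL * a * u s xL * (u s xL - g s)) - C * M).
  move=> s0; have := dE _ s0 => dEs.
  have dl : is_derive s 1 (fun r => C * M * r) (C * M).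
    by apply: is_derive_eq; rewrite /GRing.scale /= mulr1.
  exact: is_deriveB.
have EH : E t - C * M * t <= E 0 - C * M * 0.
  (* The scheme holds for positive times only; continuity on the closed interval carries the
     monotonicity down to time 0. *)
  apply: (@ler0_derive1_nincr _ (fun r => E r - C * M * r) 0 t) => //.
  - by move=> s; rewrite in_itv /= => /andP[s0 _]; case: (dH s s0).
  - move=> s; rewrite in_itv /= => /andP[s0 st].
    rewrite derive1E; case: (dH s s0) => _ ->; rewrite subr_le0.
    apply: le_trans (sat_boundary_bound _ _ _ ha htauL) _.
    by rewrite ler_wpM2l//; apply: within_itv0_sqr_le_sup => //; exact: ltW.
  - apply: within_continuousB => // x.
    by apply: cvgM; [exact: cvg_cst|exact: (continuous_subspaceT (fun _ => cvg_id))].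
have -> : l2norm_sq xL xR uinitN = E 0.
  rewrite -EE//; apply: eq_Rintegral => x; rewrite inE => xI.
  by rewrite (sol_init sol).
rewrite EE//.
have M0 : 0 <= M.
  by apply: le_trans (within_itv0_sqr_le_sup cg (lexx 0) t0); rewrite sqr_ge0.
have E0 : 0 <= E 0.
  by rewrite -EE//; apply: Rintegral_ge0 => x _; rewrite sqr_ge0.
rewrite -/M.
(* [E t <= E 0 + C * t * M] falls short of the claimed bound by [M + C * t * E 0], which is
   nonnegative. *)
have := mulr_ge0 (mulr_ge0 C0 t0) E0.
by move: EH; rewrite mulr0 subr0; lra.
Unshelve. all: by end_near. Qed.
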